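(* Let $f\in C(I,I)$ with $h(f)=0$. Then the proximal relation $\mathrm{Prox}_f=\{\langle x,y\rangle\in I^2:\langle x,y\rangle\text{ is proximal}\}$ is an equivalence relation on $I$.
   Context: $I=[0,1]$, $C(I,I)$ continuous self-maps of $I$, $h(f)$ topological entropy. A pair $\langle x,y\rangle\in I^2$ is proximal if $\liminf_{n\to\infty}|f^n(x)-f^n(y)|=0$. *)

(* Defs.v *)
From Stdlib Require Import Reals Lra List.
Open Scope R_scope.

Definition inI (x : R) : Prop := 0 <= x <= 1.

Definition maps_I (f : R -> R) : Prop := forall x, inI x -> inI (f x).
Definition cont_on_I (f : R -> R) : Prop :=
  forall x, inI x -> forall eps, eps > 0 -> exists delta, delta > 0 /\
    forall y, inI y -> Rabs (y - x) < delta -> Rabs (f y - f x) < eps.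
Definition CII (f : R -> R) : Prop := maps_I f /\ cont_on_I f.

Definition iter (f : R -> R) (n : nat) (x : R) : R := Nat.iter n f x.

Definition separated (f : R -> R) (n : nat) (eps : R) (E : list R) : Prop :=
  NoDup E /\ (forall x, In x E -> inI x) /\
  forall x y, In x E -> In y E -> x <> y ->
    exists k, (k < n)%nat /\ Rabs (iter f k x - iter f k y) > eps.

(* h(f) = sup_{eps>0} limsup_n (1/n) ln s(n,eps), s(n,eps) = max cardinality of
   an (n,eps)-separated set.  Since s(n,eps) >= 1 every limsup is >= 0, so
   h(f) = 0 iff for every eps > 0, limsup_n (1/n) ln s(n,eps) <= 0, i.e.
   for every delta > 0, eventually every (n,eps)-separated set has
   at most exp(delta*n) elements.  This is the literal unfolding. *)
Definition zero_entropy (f : R -> R) : Prop :=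
  forall eps, eps > 0 -> forall delta, delta > 0 ->
    exists N : nat, forall n : nat, (n >= N)%nat -> forall E : list R,
      separated f n eps E -> INR (length E) <= exp (delta * INR n).

(* liminf_n |f^n x - f^n y| = 0 (distances are nonnegative). *)
Definition proximal (f : R -> R) (x y : R) : Prop :=
  forall eps, eps > 0 -> forall N : nat, exists n : nat,
    (n >= N)%nat /\ Rabs (iter f n x - iter f n y) < eps.

Definition equivalence_on_I (P : R -> R -> Prop) : Prop :=
  (forall x, inI x -> P x x) /\
  (forall x y, inI x -> inI y -> P x y -> P y x) /\
  (forall x y z, inI x -> inI y -> inI z -> P x y -> P y z -> P x z).

(* Main.v *)
Require Import Defs.
From Stdlib Require Import Reals.
From Stdlib Require Import Lra Lia List Classical ClassicalEpsilon Wf_nat.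
Open Scope R_scope.

(** Zero entropy excludes horseshoes for all iterates.  Hence, along any orbit, the points moving up lie to the left of the points moving down, and an orbit that does not converge eventually alternates around a fixed point.  Applying this to f, f^2, f^4, ... one gets for every k: the tails of the 2^k subsequences (f^(i + 2^k j) x)_j either become small, or occupy non-overlapping intervals; in all cases their diameters sum to at most 2.  For k large some residue i has small diameters for x, y and z simultaneously, and a proximal pair is proximal along every residue, so the closeness of x to y and of y to z can be transported to a common time. *)

(** * Iterates, continuity and intermediate values *)

Lemma least_nat (P : nat -> Prop) : (exists n, P n) ->
  exists n, P n /\ forall m, (m < n)%nat -> ~ P m.
Proof.
  intros [n Hn]. apply NNPP. intros Hno. revert Hn.
  induction n as [n IH] using lt_wf_ind. intros Hn. apply Hno. exists n. auto.
Qed.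

Lemma iter_S (g : R -> R) n x : iter g (S n) x = g (iter g n x).
Proof. reflexivity. Qed.

Lemma iter_add (g : R -> R) n m x : iter g (n + m) x = iter g n (iter g m x).
Proof. induction n as [|n IH]; [reflexivity|]. cbn [Nat.add]. rewrite !iter_S, IH. reflexivity. Qed.

Lemma iter_S_r (g : R -> R) n x : iter g (S n) x = iter g n (g x).
Proof. replace (S n) with (n + 1)%nat by lia. rewrite iter_add. reflexivity. Qed.

Lemma iter_fixed (g : R -> R) n z : g z = z -> iter g n z = z.
Proof. intros H; induction n as [|n IH]; [reflexivity|]. rewrite iter_S, IH; exact H. Qed.

Lemma iter_shift (g : R -> R) x n m : (n <= m)%nat ->
  iter g (m - n) (iter g n x) = iter g m x.
Proof. intros H. rewrite <- iter_add. f_equal. lia. Qed.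

Lemma iter_double (g : R -> R) n x : iter (fun t => g (g t)) n x = iter g (2 * n) x.
Proof.
  induction n as [|n IH]; [reflexivity|].
  replace (2 * S n)%nat with (S (S (2 * n))) by lia. rewrite !iter_S, IH. reflexivity.
Qed.

Lemma iter_maps_I (g : R -> R) n x : maps_I g -> inI x -> inI (iter g n x).
Proof. intros H Hx; induction n as [|n IH]; [exact Hx|]. rewrite iter_S. auto. Qed.

Lemma iter_continuity (g : R -> R) n : continuity g -> continuity (iter g n).
Proof.
  intros H; induction n as [|n IH].
  - intros x. apply (derivable_continuous_pt id). apply derivable_pt_id.
  - exact (continuity_comp (iter g n) g IH H).
Qed.

Lemma continuity_eps (g : R -> R) x : continuity g ->
  forall eps, eps > 0 -> exists d, d > 0 /\
    forall y, Rabs (y - x) < d -> Rabs (g y - g x) < eps.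
Proof.
  intros H eps He. destruct (H x eps He) as [d [Hd Hy]].
  exists d; split; [exact Hd|]. intros y Hyx.
  (* The limit behind [continuity] excludes the centre, so y = x is treated apart. *)
  destruct (Req_dec x y) as [->|Hne].
  - replace (g y - g y) with 0 by ring. rewrite Rabs_R0. exact He.
  - apply (Hy y). split; [split; [exact I|exact Hne]|exact Hyx].
Qed.

Lemma moves_up_near (g : R -> R) x : continuity g -> x < g x ->
  exists d, d > 0 /\ forall y, Rabs (y - x) < d -> y < g y.
Proof.
  intros Hc Hx. destruct (continuity_eps g x Hc ((g x - x) / 2)) as [d [Hd H]]; [lra|].
  exists (Rmin d ((g x - x) / 2)). split; [apply Rmin_glb_lt; lra|].
  intros y Hy. assert (H1 := Rmin_l d ((g x - x) / 2)). assert (H2 := Rmin_r d ((g x - x) / 2)).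
  assert (H3 : Rabs (g y - g x) < (g x - x) / 2) by (apply H; lra).
  assert (H4 : Rabs (y - x) < (g x - x) / 2) by lra.
  apply Rabs_def2 in H3; apply Rabs_def2 in H4; lra.
Qed.

Lemma moves_down_near (g : R -> R) x : continuity g -> g x < x ->
  exists d, d > 0 /\ forall y, Rabs (y - x) < d -> g y < y.
Proof.
  intros Hc Hx. destruct (continuity_eps g x Hc ((x - g x) / 2)) as [d [Hd H]]; [lra|].
  exists (Rmin d ((x - g x) / 2)). split; [apply Rmin_glb_lt; lra|].
  intros y Hy. assert (H1 := Rmin_l d ((x - g x) / 2)). assert (H2 := Rmin_r d ((x - g x) / 2)).
  assert (H3 : Rabs (g y - g x) < (x - g x) / 2) by (apply H; lra).
  assert (H4 : Rabs (y - x) < (x - g x) / 2) by lra.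
  apply Rabs_def2 in H3; apply Rabs_def2 in H4; lra.
Qed.

Lemma intermediate_value (h : R -> R) p q y : continuity h -> p <= q ->
  h p <= y <= h q \/ h q <= y <= h p -> exists x, p <= x <= q /\ h x = y.
Proof.
  intros Hc Hpq Hy.
  destruct (IVT_cor (fun x => h x - y) p q) as [x [Hx E]].
  - apply (continuity_minus h (fct_cte y)); [exact Hc|].
    apply continuity_const. intros a b; reflexivity.
  - exact Hpq.
  - destruct Hy; nra.
  - exists x; split; [exact Hx|lra].
Qed.

(** * Horseshoes force positive entropy *)

(* Two branches of different lengths p and p + q issue from K: stay in K after time p, or visit J at time p and be back in K at time p + q. *)
Definition no_horseshoe (g : R -> R) : Prop :=
  forall (p q : nat) (d : R) (J K : R -> Prop), (0 < q)%nat -> 0 < d ->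
    (exists y, K y) -> (forall y, K y -> inI y) ->
    (forall y, K y -> exists x, K x /\ iter g p x = y) ->
    (forall y, K y -> exists x, K x /\ J (iter g p x) /\ iter g (q + p) x = y) ->
    (forall y u, K y -> J u -> K (iter g q u) -> d <= Rabs (y - u)) -> False.

Lemma choice_on (K : R -> Prop) (Q : R -> R -> Prop) :
  (forall y, K y -> exists x, Q y x) -> exists phi : R -> R, forall y, K y -> Q y (phi y).
Proof.
  intros H.
  assert (H' : forall y, exists x, K y -> Q y x).
  { intros y. destruct (classic (K y)) as [Hy|Hy].
    - destruct (H y Hy) as [x Hx]. exists x; auto.
    - exists 0; tauto. }
  exists (fun y => proj1_sig (constructive_indefinite_description _ (H' y))).
  intros y. exact (proj2_sig (constructive_indefinite_description _ (H' y))).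
Qed.

(** Pulling a separated set back along both branches doubles its size and costs p + q more units of
    time. Repeating this m times gives 2^m separated points at time m (p + q), which is exponential
    growth. *)
Lemma zero_entropy_no_horseshoe (g : R -> R) : zero_entropy g -> no_horseshoe g.
Proof.
  intros Hent p q d J K Hq Hd [y0 Hy0] HKI H0 H1 Hgap.
  apply choice_on in H0. destruct H0 as [phi0 H0].
  apply choice_on in H1. destruct H1 as [phi1 H1].
  (* Halving d turns the weak gap of [no_horseshoe] into the strict inequality of [separated]. *)
  assert (Hsep : forall m, exists E, separated g (m * (p + q)) (d / 2) E /\
    (forall x, In x E -> K x) /\ length E = (2 ^ m)%nat).
  { induction m as [|m [E [[Hnd [_ Hs]] [HK Hlen]]]].
    - exists (y0 :: nil). split; [split; [|split]|split].
      + constructor; [intros []|constructor].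
      + intros x [<-|[]]. auto.
      + intros x y [<-|[]] [<-|[]] Hne. congruence.
      + intros x [<-|[]]. exact Hy0.
      + reflexivity.
    (* Time p separates the two branches: the first has arrived at y in K, the second is in J and
       returns to K after q more steps. Two points on the same branch inherit the separation of
       their images, delayed by p or by q + p. *)
    - assert (Hcross : forall y y', In y E -> In y' E ->
        d <= Rabs (iter g p (phi0 y) - iter g p (phi1 y'))).
      { intros y y' Hy Hy'. destruct (H0 y (HK y Hy)) as [_ ->].
        destruct (H1 y' (HK y' Hy')) as [_ [HJ HE]].
        apply Hgap; auto. rewrite <- iter_add, HE. auto. }
      assert (HKE : forall x, In x (map phi0 E ++ map phi1 E) -> K x).
      { intros x Hx. apply in_app_or in Hx.
        destruct Hx as [Hx|Hx]; apply in_map_iff in Hx; destruct Hx as [y [<- Hy]].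
        - apply H0; auto.
        - apply H1; auto. }
      exists (map phi0 E ++ map phi1 E). split; [split; [|split]|split].
      + apply NoDup_app.
        * apply NoDup_map_NoDup_ForallPairs; [|exact Hnd].
          intros y y' Hy Hy' Heq.
          destruct (H0 y (HK y Hy)) as [_ <-]. destruct (H0 y' (HK y' Hy')) as [_ <-].
          rewrite Heq. reflexivity.
        * apply NoDup_map_NoDup_ForallPairs; [|exact Hnd].
          intros y y' Hy Hy' Heq.
          destruct (H1 y (HK y Hy)) as [_ [_ <-]]. destruct (H1 y' (HK y' Hy')) as [_ [_ <-]].
          rewrite Heq. reflexivity.
        * intros x Hx Hx'. apply in_map_iff in Hx; destruct Hx as [y [<- Hy]].
          apply in_map_iff in Hx'; destruct Hx' as [y' [Heq Hy']].
          assert (Hc := Hcross y y' Hy Hy'). rewrite Heq in Hc.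
          rewrite Rminus_diag, Rabs_R0 in Hc. lra.
      + intros x Hx. apply HKI, HKE, Hx.
      + intros x x' Hx Hx' Hne. apply in_app_or in Hx; apply in_app_or in Hx'.
        destruct Hx as [Hx|Hx]; apply in_map_iff in Hx; destruct Hx as [y [<- Hy]];
        destruct Hx' as [Hx'|Hx']; apply in_map_iff in Hx'; destruct Hx' as [y' [<- Hy']].
        * destruct (Hs y y' Hy Hy') as [k [Hk HR]]; [congruence|].
          exists (k + p)%nat. split; [cbn [Nat.mul]; lia|]. rewrite !iter_add.
          destruct (H0 y (HK y Hy)) as [_ ->]. destruct (H0 y' (HK y' Hy')) as [_ ->]. exact HR.
        * exists p. split; [cbn [Nat.mul]; lia|].
          assert (Hc := Hcross y y' Hy Hy'). lra.
        * exists p. split; [cbn [Nat.mul]; lia|].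
          assert (Hc := Hcross y' y Hy' Hy). rewrite Rabs_minus_sym. lra.
        * destruct (Hs y y' Hy Hy') as [k [Hk HR]]; [congruence|].
          exists (k + (q + p))%nat. split; [cbn [Nat.mul]; lia|]. rewrite !(iter_add g k).
          destruct (H1 y (HK y Hy)) as [_ [_ ->]]. destruct (H1 y' (HK y' Hy')) as [_ [_ ->]].
          exact HR.
      + exact HKE.
      + rewrite length_app, !length_map, Hlen. cbn [Nat.pow]. lia. }
  assert (Hln : 0 < ln 2) by (rewrite <- ln_1; apply ln_increasing; lra).
  assert (HT : 0 < INR (p + q)) by (apply lt_0_INR; lia).
  (* The doubling has growth rate ln 2 / (p + q); half of it is a positive rate that the separated
     sets then exceed. *)
  destruct (Hent (d / 2)) with (delta := ln 2 / (2 * INR (p + q))) as [N HN].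
  { lra. }
  { apply Rdiv_lt_0_compat; lra. }
  destruct (Hsep (S N)) as [E [HE [_ Hlen]]].
  assert (Hbound : INR (length E) <= exp (ln 2 / (2 * INR (p + q)) * INR (S N * (p + q)))).
  { apply HN; [nia|exact HE]. }
  rewrite Hlen, pow_INR, mult_INR in Hbound.
  replace (INR 2) with 2 in Hbound by (simpl; lra).
  replace (ln 2 / (2 * INR (p + q)) * (INR (S N) * INR (p + q))) with (INR (S N) * ln 2 / 2)
    in Hbound by (field; lra).
  rewrite <- Rpower_pow in Hbound by lra. unfold Rpower in Hbound.
  assert (HSN : 0 < INR (S N)) by (apply lt_0_INR; lia).
  assert (exp (INR (S N) * ln 2 / 2) < exp (INR (S N) * ln 2)) by (apply exp_increasing; nra).
  lra.
Qed.

(** * Maps without horseshoes: squares, reflections, intervals *)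

(** Entropy is replaced by [no_horseshoe], which passes directly to g o g and to the reflected map:
    a horseshoe of g o g with times p, q is one of g with times 2p, 2q. *)
Definition tame (g : R -> R) : Prop :=
  continuity g /\ maps_I g /\ no_horseshoe g.

Lemma tame_double g : tame g -> tame (fun t => g (g t)).
Proof.
  intros [Hc [HI Hh]]. split; [|split].
  - exact (continuity_comp g g Hc Hc).
  - intros x Hx. auto.
  - intros p q d J K Hq Hd Hne HKI H0 H1 Hgap.
    apply (Hh (2 * p)%nat (2 * q)%nat d J K); auto; [lia| | |].
    + intros y Hy. destruct (H0 y Hy) as [x [Hx E]]. exists x. rewrite <- iter_double. auto.
    + intros y Hy. destruct (H1 y Hy) as [x [Hx [HJ E]]]. exists x.
      replace (2 * q + 2 * p)%nat with (2 * (q + p))%nat by lia. rewrite <- !iter_double. auto.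
    + intros y u Hy Hu HK. apply Hgap; auto. rewrite iter_double. exact HK.
Qed.

(** The conjugate of g by the reflection of I. It exchanges moving up and moving down, so each
    one-sided result yields its counterpart. *)
Definition mirror (g : R -> R) (x : R) : R := 1 - g (1 - x).

Lemma iter_mirror g n x : iter (mirror g) n x = 1 - iter g n (1 - x).
Proof.
  induction n as [|n IH]; [unfold iter; simpl; ring|].
  rewrite !iter_S, IH. unfold mirror. do 2 f_equal. ring.
Qed.

Lemma tame_mirror g : tame g -> tame (mirror g).
Proof.
  intros [Hc [HI Hh]]. split; [|split].
  - assert (Hr : continuity (fun x => 1 - x)).
    { apply (continuity_minus (fct_cte 1) id).
      - apply continuity_const. intros a b; reflexivity.
      - apply derivable_continuous, derivable_id. }
    exact (continuity_comp _ _ (continuity_comp _ _ Hr Hc) Hr).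
  - intros x Hx. unfold mirror, inI in *. specialize (HI (1 - x)). unfold inI in HI. lra.
  - intros p q d J K Hq Hd [y0 Hy0] HKI H0 H1 Hgap.
    assert (Hinv : forall t, 1 - (1 - t) = t) by (intros; ring).
    apply (Hh p q d (fun u => J (1 - u)) (fun u => K (1 - u))); auto.
    + exists (1 - y0). rewrite Hinv. exact Hy0.
    + intros y Hy. apply HKI in Hy. unfold inI in *. lra.
    + intros y Hy. destruct (H0 _ Hy) as [x [Hx E]]. exists (1 - x).
      rewrite iter_mirror in E. rewrite Hinv. split; [exact Hx|lra].
    + intros y Hy. destruct (H1 _ Hy) as [x [Hx [HJ E]]]. exists (1 - x).
      rewrite iter_mirror in E, HJ. rewrite Hinv. split; [exact Hx|]. split; [exact HJ|lra].
    + intros y u Hy Hu HK. rewrite Rabs_minus_sym.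
      replace (u - y) with ((1 - y) - (1 - u)) by ring.
      apply Hgap; auto. rewrite iter_mirror, Hinv. exact HK.
Qed.

(* The condition on [iter g q b] keeps the two branches apart although the intervals share the point b. *)
Lemma tame_no_interval_horseshoe g p q a b c : tame g -> (0 < q)%nat -> b <= c -> inI b -> inI c ->
  a <= b ->
  (forall y, a <= y <= c -> exists x, b <= x <= c /\ iter g p x = y) ->
  (forall y, b <= y <= c -> exists u, a <= u <= b /\ iter g q u = y) ->
  iter g q b < b \/ c < iter g q b -> False.
Proof.
  intros [Hc [HI Hh]] Hq Hbc Hb HcI Hab HK HJ Hout.
  assert (Hd : exists d, d > 0 /\ forall u, Rabs (u - b) < d -> ~ (b <= iter g q u <= c)).
  { assert (Hcq := iter_continuity g q Hc). destruct Hout as [Ho|Ho].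
    - destruct (continuity_eps _ b Hcq (b - iter g q b)) as [d [Hd H]]; [lra|].
      exists d; split; [exact Hd|]. intros u Hu. apply H in Hu. apply Rabs_def2 in Hu. lra.
    - destruct (continuity_eps _ b Hcq (iter g q b - c)) as [d [Hd H]]; [lra|].
      exists d; split; [exact Hd|]. intros u Hu. apply H in Hu. apply Rabs_def2 in Hu. lra. }
  destruct Hd as [d [Hd Hout']].
  apply (Hh p q d (fun u => a <= u <= b) (fun y => b <= y <= c)); auto.
  - exists b; lra.
  - unfold inI in *. intros; lra.
  - intros y Hy. apply HK. lra.
  - intros y Hy. destruct (HJ y Hy) as [u [Hu E]].
    destruct (HK u) as [x [Hx E']]; [lra|].
    exists x. rewrite iter_add, E'. auto.
  - intros y u Hy Hu HKu. destruct (Rlt_le_dec (Rabs (u - b)) d) as [Hlt|Hge].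
    + exfalso. exact (Hout' u Hlt HKu).
    + rewrite Rabs_left1 in Hge by lra. rewrite Rabs_right by lra. lra.
Qed.

(** * Rising points lie to the left of falling points *)

(** Moving down is an open condition, so a supremum of points that do not move down does not move
    down either. P need not be closed, hence z inherits only the upper bounds of P. *)
Lemma sup_moving_up g (P : R -> Prop) y0 M : continuity g -> P y0 -> y0 <= g y0 ->
  (forall y, P y -> y <= M) ->
  exists z, z <= g z /\ (forall y, P y -> y <= g y -> y <= z) /\
    (forall B, (forall y, P y -> y <= B) -> z <= B).
Proof.
  intros Hc HP0 Hy0 HM.
  destruct (completeness (fun y => P y /\ y <= g y)) as [z [Hub Hlub]].
  - exists M. intros y [Hy _]. auto.
  - exists y0; auto.
  - exists z. split; [|split].
    + destruct (Rle_lt_dec z (g z)) as [H|H]; [exact H|exfalso].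
      destruct (moves_down_near g z Hc H) as [d [Hd Hn]].
      assert (z <= z - d / 2); [|lra].
      apply Hlub. intros y [HPy Hy].
      destruct (Rle_lt_dec y (z - d / 2)) as [Hle|Hlt]; [exact Hle|exfalso].
      assert (y <= z) by (apply Hub; auto).
      assert (g y < y); [|lra]. apply Hn. apply Rabs_def1; lra.
    + intros y Hy1 Hy2. apply Hub; auto.
    + intros B HB. apply Hlub. intros y [Hy _]. auto.
Qed.

(** The supremum a of the points up to d that do not move down is fixed: if it moved up, so would
    points slightly to its right. *)
Lemma last_fixed_point_below g d : continuity g -> maps_I g -> inI d -> g d < d ->
  exists a, 0 <= a < d /\ g a = a /\ forall x, a < x <= d -> g x < x.
Proof.
  intros Hc HI Hd Hgd.
  destruct (sup_moving_up g (fun y => y <= d) 0 d Hc) as [a [Ha [Hub Hlub]]].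
  - apply Hd.
  - apply (HI 0). unfold inI; lra.
  - auto.
  - assert (a <= d) by (apply Hlub; auto).
    assert (a <> d) by (intros ->; lra).
    assert (H0a : 0 <= a).
    { apply Hub; [apply Hd|]. apply (HI 0). unfold inI; lra. }
    assert (Hab : forall x, a < x <= d -> g x < x).
    { intros x Hx. destruct (Rlt_le_dec (g x) x) as [H1|H1]; [exact H1|].
      assert (x <= a); [apply Hub|]; lra. }
    exists a. split; [lra|split; [|exact Hab]].
    apply Rle_antisym; [|exact Ha]. apply Rnot_lt_le. intros Hlt.
    destruct (moves_up_near g a Hc Hlt) as [e [He Hn]].
    set (x := Rmin (a + e / 2) d).
    assert (x <= a + e / 2) by apply Rmin_l. assert (x <= d) by apply Rmin_r.
    assert (a < x) by (apply Rmin_glb_lt; lra).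
    assert (x < g x) by (apply Hn, Rabs_def1; lra).
    specialize (Hab x). lra.
Qed.

(* Leaving (a, d] downwards past the fixed point a and later arriving beyond the fixed point c creates a horseshoe on [a, b], [b, c]. *)
Lemma down_before_up g m d : tame g -> inI d -> g d < d ->
  d < iter g m d -> iter g m d < g (iter g m d) -> False.
Proof.
  intros Hg Hd Hgd Hdu Hgu. destruct (Hg) as [Hc [HI _]].
  destruct (last_fixed_point_below g d Hc HI Hd Hgd) as [a [Ha [Hfa Hlow]]].
  assert (Hu := iter_maps_I g m d HI Hd).
  destruct (intermediate_value (fun x => g x - x) d (iter g m d) 0) as [c [Hcd Hfc]].
  { apply (continuity_minus g id); [exact Hc|]. apply derivable_continuous, derivable_id. }
  { lra. }
  { left; lra. }
  assert (c <> d) by (intros ->; lra).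
  assert (c <> iter g m d) by (intros ->; lra).
  (* k is the last time before the first exit from (a, d]. All points there move down, so the exit
     is to the left, at or below a. *)
  assert (Hex : exists k, (k < m)%nat /\ a < iter g k d <= d /\ iter g (S k) d <= a).
  { assert (Hw : exists k, (k <= m)%nat /\ ~ (a < iter g k d <= d)) by (exists m; split; [lia|lra]).
    apply least_nat in Hw. destruct Hw as [k [[Hkm Hk] Hmin]].
    destruct k as [|k]; [exfalso; apply Hk; change (iter g 0 d) with d; lra|].
    assert (Hin : a < iter g k d <= d).
    { apply NNPP. intros Hn. apply (Hmin k); [lia|]. split; [lia|exact Hn]. }
    exists k. split; [lia|split; [exact Hin|]].
    rewrite iter_S in *. specialize (Hlow _ Hin). apply Rnot_lt_le. intros Hlt. apply Hk. lra. }
  destruct Hex as [k [Hkm [Hb Hgb]]]. set (b := iter g k d) in *.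
  assert (Hbu : iter g (m - k) b = iter g m d) by (apply iter_shift; lia).
  rewrite iter_S in Hgb. fold b in Hgb.
  unfold inI in *.
  (* One step takes b to a or below and fixes c, so [b, c] covers [a, c]. In m - k steps a stays
     fixed while b goes beyond c, so [a, b] covers [b, c]. *)
  apply (tame_no_interval_horseshoe g 1 (m - k) a b c); auto; unfold inI; try lra; try lia.
  - intros y Hy. apply (intermediate_value (iter g 1)); [apply iter_continuity, Hc|lra|].
    left. change (iter g 1 b) with (g b). change (iter g 1 c) with (g c). lra.
  - intros y Hy. apply (intermediate_value (iter g (m - k))); [apply iter_continuity, Hc|lra|].
    left. rewrite Hbu, (iter_fixed g _ a Hfa). lra.
Qed.

Lemma up_before_down g m u : tame g -> inI u -> u < g u ->
  iter g m u < u -> g (iter g m u) < iter g m u -> False.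
Proof.
  intros Hg Hu H1 H2 H3.
  assert (E : 1 - (1 - u) = u) by ring.
  apply (down_before_up (mirror g) m (1 - u) (tame_mirror g Hg)).
  - unfold inI in *; lra.
  - unfold mirror. rewrite E. lra.
  - rewrite iter_mirror, E. lra.
  - rewrite iter_mirror, E. unfold mirror.
    replace (1 - (1 - iter g m u)) with (iter g m u) by ring. lra.
Qed.

(** * Orbits that do not converge alternate around a fixed point *)

Definition converges (u : nat -> R) : Prop := exists p, Un_cv u p.

Lemma converges_shift u n : converges (fun k => u (n + k)%nat) -> converges u.
Proof.
  intros [p Hp]. exists p. intros eps He. destruct (Hp eps He) as [N HN].
  exists (n + N)%nat. intros k Hk. replace k with (n + (k - n))%nat by lia. apply HN. lia.
Qed.

Lemma eventually_increasing_converges u n : (forall k, inI (u k)) ->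
  (forall k, (n <= k)%nat -> u k <= u (S k)) -> converges u.
Proof.
  intros HI Hinc. apply (converges_shift u n).
  destruct (Un_cv_crit (fun k => u (n + k)%nat)) as [l Hl].
  - intros k. rewrite Nat.add_succ_r. apply Hinc. lia.
  - exists 1. intros x [k ->]. apply HI.
  - exists l; exact Hl.
Qed.

Lemma converges_mirror u : converges (fun n => 1 - u n) -> converges u.
Proof.
  intros [p Hp]. exists (1 - p). intros eps He. destruct (Hp eps He) as [N HN].
  exists N. intros n Hn. specialize (HN n Hn). unfold Rdist in *.
  replace (u n - (1 - p)) with (- (1 - u n - p)) by ring. rewrite Rabs_Ropp. exact HN.
Qed.

Lemma eventually_decreasing_converges u n : (forall k, inI (u k)) ->
  (forall k, (n <= k)%nat -> u (S k) <= u k) -> converges u.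
Proof.
  intros HI Hdec. apply converges_mirror. apply (eventually_increasing_converges _ n).
  - intros k. specialize (HI k). unfold inI in *; lra.
  - intros k Hk. specialize (Hdec k Hk). lra.
Qed.

(** Such an orbit never meets a fixed point and is not monotone, so it has rising and falling
    points, and every rising one is at or below every falling one. A fixed point in between
    separates them. *)
Lemma nonconvergent_orbit_divided g x : tame g -> inI x -> ~ converges (fun n => iter g n x) ->
  exists z, g z = z /\ inI z /\ forall n,
    (iter g n x < z /\ iter g n x < iter g (S n) x) \/ (z < iter g n x /\ iter g (S n) x < iter g n x).
Proof.
  intros Hg Hx Hnc. destruct (Hg) as [Hc [HI _]].
  assert (HIn : forall n, inI (iter g n x)) by (intros; apply iter_maps_I; auto).
  assert (Hnf : forall n, g (iter g n x) <> iter g n x).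
  { intros n Hn. apply Hnc. apply (converges_shift _ n). exists (iter g n x).
    intros eps He. exists 0%nat. intros k _. unfold Rdist.
    rewrite Nat.add_comm, iter_add, iter_fixed by exact Hn. rewrite Rminus_diag, Rabs_R0. lra. }
  assert (Hup : exists i, iter g i x < g (iter g i x)).
  { apply NNPP. intros Hno. apply Hnc. apply (eventually_decreasing_converges _ 0); [exact HIn|].
    intros k _. rewrite iter_S. apply Rnot_lt_le. intros Hlt. apply Hno. exists k; exact Hlt. }
  assert (Hdown : exists i, g (iter g i x) < iter g i x).
  { apply NNPP. intros Hno. apply Hnc. apply (eventually_increasing_converges _ 0); [exact HIn|].
    intros k _. rewrite iter_S. apply Rnot_lt_le. intros Hlt. apply Hno. exists k; exact Hlt. }
  assert (Hord : forall i j, iter g i x < g (iter g i x) -> g (iter g j x) < iter g j x ->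
    iter g i x <= iter g j x).
  { intros i j Hi Hj. apply Rnot_lt_le. intros Hlt.
    destruct (Nat.le_gt_cases i j) as [Hij|Hij].
    - apply (up_before_down g (j - i) (iter g i x)); auto; rewrite iter_shift by lia; auto.
    - apply (down_before_up g (i - j) (iter g j x)); auto; rewrite iter_shift by lia; auto. }
  destruct Hup as [i0 Hi0]. destruct Hdown as [j0 Hj0].
  (* The supremum runs over all real points below the falling orbit points, not just over the orbit:
     this makes z fixed, since if z moved up, points just beyond it would still qualify. *)
  destruct (sup_moving_up g
    (fun y => forall j, g (iter g j x) < iter g j x -> y <= iter g j x)
    (iter g i0 x) (iter g j0 x) Hc) as [z [Hz [Hub Hlub]]].
  { intros j Hj. apply Hord; auto. }
  { lra. }
  { intros y Hy. apply Hy, Hj0. }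
  assert (Hzf : g z = z).
  { apply Rle_antisym; [|exact Hz]. apply Rnot_lt_le. intros Hlt.
    destruct (moves_up_near g z Hc Hlt) as [e [He Hn]].
    assert (z + e / 2 <= z); [|lra]. apply Hub.
    - intros j Hj. apply Rnot_lt_le. intros Hjz.
      assert (z <= iter g j x) by (apply Hlub; intros y Hy; apply Hy, Hj).
      assert (iter g j x < g (iter g j x)); [|lra]. apply Hn, Rabs_def1; lra.
    - apply Rlt_le, Hn, Rabs_def1; lra. }
  assert (Hi0z : iter g i0 x <= z) by (apply Hub; [intros j Hj; apply Hord; auto|lra]).
  assert (Hj0z : z <= iter g j0 x) by (apply Hlub; intros y Hy; apply Hy, Hj0).
  exists z. split; [exact Hzf|split].
  - assert (H1 := HIn i0). assert (H2 := HIn j0). unfold inI in *; lra.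
  - intros n. rewrite iter_S.
    destruct (Rtotal_order (iter g n x) (g (iter g n x))) as [H|[H|H]].
    + left. split; [|exact H].
      assert (Hle : iter g n x <= z) by (apply Hub; [intros j Hj; apply Hord; auto|lra]).
      destruct Hle as [Hle|E]; [exact Hle|]. rewrite E in H. lra.
    + exfalso. apply (Hnf n). congruence.
    + right. split; [|exact H].
      assert (Hle : z <= iter g n x) by (apply Hlub; intros y Hy; apply Hy, H).
      destruct Hle as [Hle|E]; [exact Hle|]. rewrite <- E in H. lra.
Qed.

(** Call n a double rise ([UU]) if the orbit is below z at times n and n + 1. If there were
    infinitely many, their points would increase to a limit l, which must be fixed. For l < z the
    orbit would finally stay below l and increase; for l = z it would converge to z. *)
Lemma finitely_many_double_rises g x z : tame g -> inI x ->
  ~ converges (fun n => iter g n x) -> g z = z -> inI z ->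
  (forall n, (iter g n x < z /\ iter g n x < iter g (S n) x) \/
             (z < iter g n x /\ iter g (S n) x < iter g n x)) ->
  exists N, forall n, (N <= n)%nat -> iter g n x < z -> z < iter g (S n) x.
Proof.
  intros Hg Hx Hnc Hz HzI Hdiv. destruct (Hg) as [Hc [HI _]].
  set (X := fun n => iter g n x) in *.
  assert (HIn : forall n, inI (X n)) by (intros; apply iter_maps_I; auto).
  change (forall n, (X n < z /\ X n < X (S n)) \/ (z < X n /\ X (S n) < X n)) in Hdiv.
  set (UU := fun n => X n < z /\ X (S n) < z).
  apply NNPP. intros Hno.
  assert (Hinf : forall N, exists n, (N <= n)%nat /\ UU n).
  { intros N. apply NNPP. intros Hn. apply Hno. exists N. intros n HNn Hnz.
    change (iter g (S n) x) with (X (S n)).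
    destruct (Hdiv (S n)) as [[H _]|[H _]]; [|exact H].
    exfalso. apply Hn. exists n. split; [exact HNn|]. split; [exact Hnz|exact H]. }
  assert (Hshift : forall n m, (n <= m)%nat -> iter g (m - n) (X n) = X m)
    by (intros; apply iter_shift; auto).
  (* A first return to the left of x_n would come from a point beyond z, and give a horseshoe on [x_n, x_(n+1)], [x_(n+1), z]. *)
  assert (Hnoret : forall n m, UU n -> (n < m)%nat -> X n < X m).
  { intros n m [Hn Hn1] Hnm. apply Rnot_le_lt. intros Hret.
    assert (Hlt : X n < X (S n)) by (destruct (Hdiv n); lra).
    destruct (least_nat (fun m => (n < m)%nat /\ X m <= X n)) as [m' [[Hnm' Hm'] Hmin]].
    { exists m; auto. }
    destruct m' as [|m']; [lia|].
    assert (Hne : m' <> n) by (intros ->; lra).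
    assert (Hgt : X n < X m').
    { apply Rnot_le_lt. intros Hle. apply (Hmin m'); [lia|]. split; [lia|exact Hle]. }
    assert (Hzm : z < X m') by (destruct (Hdiv m'); lra).
    assert (E1 : iter g (m' - n) (X n) = X m') by (apply Hshift; lia).
    assert (E2 : iter g (m' - n) (X (S n)) = X (S m')).
    { replace (m' - n)%nat with (S m' - S n)%nat by lia. apply Hshift. lia. }
    assert (E3 := iter_fixed g (m' - n) z Hz).
    assert (Hcq := iter_continuity g (m' - n) Hc).
    apply (tame_no_interval_horseshoe g (m' - n) (m' - n) (X n) (X (S n)) z); auto;
      try lra; try lia.
    - intros y Hy. apply (intermediate_value _ _ _ _ Hcq); lra.
    - intros y Hy. apply (intermediate_value _ _ _ _ Hcq); lra. }
  destruct (completeness (fun y => exists n, UU n /\ y = X n)) as [l [Hub Hlub]].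
  { exists z. intros y [n [[Hn _] ->]]. lra. }
  { destruct (Hinf 0%nat) as [n [_ Hn]]. exists (X n), n. auto. }
  assert (HUl : forall n, UU n -> X n < l).
  { intros n Hn. destruct (Hinf (S n)) as [m [Hm Hm']].
    assert (X n < X m) by (apply Hnoret; [exact Hn|lia]).
    assert (X m <= l) by (apply Hub; exists m; auto). lra. }
  assert (Hlz : l <= z) by (apply Hlub; intros y [n [[Hn _] ->]]; lra).
  assert (Hnear : forall d, d > 0 -> exists n, UU n /\ forall m, (n <= m)%nat -> l - d < X m).
  { intros d Hd. apply NNPP. intros Hn.
    assert (l <= l - d); [|lra]. apply Hlub. intros y [n [Hn' ->]].
    apply Rnot_lt_le. intros Hlt. apply Hn. exists n. split; [exact Hn'|].
    intros m Hm. destruct (Nat.eq_dec n m) as [<-|Hne]; [exact Hlt|].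
    assert (X n < X m) by (apply Hnoret; [exact Hn'|lia]). lra. }
  assert (Hgl : l <= g l).
  { apply Rnot_lt_le. intros Hlt. destruct (moves_down_near g l Hc Hlt) as [d [Hd Hn]].
    destruct (Hnear d Hd) as [n [Hn' Hm]]. specialize (Hm n (le_n n)).
    assert (HnU := HUl n Hn').
    assert (g (X n) < X n) by (apply Hn, Rabs_def1; lra).
    change (X (S n)) with (g (X n)) in *. destruct Hn' as [Hn' _].
    destruct (Hdiv n) as [H1|H1]; change (X (S n)) with (g (X n)) in H1; lra. }
  assert (Hfl : g l = l).
  (* If g l > l, late double rises jump from just left of l into (l, z). Two consecutive ones,
     preceded by a third at time n, produce a horseshoe. *)
  { apply Rle_antisym; [|exact Hgl]. apply Rnot_lt_le. intros Hlt.
    destruct (continuity_eps g l Hc (g l - l)) as [d [Hd Hcd]]; [lra|].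
    destruct (Hnear d Hd) as [n [Hn Hm]].
    assert (Hjump : forall k, (n <= k)%nat -> UU k -> l < X (S k) < z).
    { intros k Hk HU. split; [|apply HU]. specialize (Hm k Hk). assert (HkU := HUl k HU).
      assert (HR : Rabs (g (X k) - g l) < g l - l) by (apply Hcd, Rabs_def1; lra).
      apply Rabs_def2 in HR. change (X (S k)) with (g (X k)). lra. }
    destruct (Hinf (S n)) as [n1 [Hn1 HU1]].
    destruct (least_nat (fun m => (n1 < m)%nat /\ UU m)) as [n2 [[Hn2 HU2] Hmin]].
    { destruct (Hinf (S n1)) as [m [Hm1 Hm2]]. exists m. split; [lia|exact Hm2]. }
    destruct n2 as [|n2]; [lia|].
    assert (Hb := Hjump n (le_n n) Hn). assert (Hb1 := Hjump n1 ltac:(lia) HU1).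
    assert (Hl1 := HUl n1 HU1). assert (Hl2 := HUl (S n2) HU2).
    assert (H12 : X n1 < X (S n2)) by (apply Hnoret; [exact HU1|lia]).
    assert (Hne : n2 <> n1) by (intros ->; lra).
    (* [S n2] is the first double rise after n1, so the orbit comes to it from beyond z. *)
    assert (Hbig : z < X n2).
    { destruct (Hdiv n2) as [[H1 _]|[H1 _]]; [|exact H1]. exfalso.
      apply (Hmin n2); [lia|]. split; [lia|]. split; [exact H1|apply HU2]. }
    assert (E1 : iter g (n2 - n1) (X n1) = X n2) by (apply Hshift; lia).
    assert (E2 : iter g (n2 - n1) (X (S n1)) = X (S n2)).
    { replace (n2 - n1)%nat with (S n2 - S n1)%nat by lia. apply Hshift. lia. }
    assert (E3 : iter g (n1 - S n) (X (S n)) = X n1) by (apply Hshift; lia).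
    assert (F1 := iter_fixed g (n2 - n1) z Hz). assert (F2 := iter_fixed g (n1 - S n) z Hz).
    apply (tame_no_interval_horseshoe g (n1 - S n + (n2 - n1)) (n2 - n1) (X n1) (X (S n1)) z);
      auto; try lra; try lia.
    (* One pass of n2 - n1 steps over [X (S n1), z] reaches down only to X (S n2), which is still
       right of X n1. It does cover [X (S n), z], and the orbit segment from time S n to n1
       stretches this over [X n1, z]. *)
    - intros y Hy.
      destruct (intermediate_value (iter g (n1 - S n)) (X (S n)) z y) as [v [Hv Ev]];
        [apply iter_continuity, Hc|lra|lra|].
      destruct (intermediate_value (iter g (n2 - n1)) (X (S n1)) z v) as [w [Hw Ew]];
        [apply iter_continuity, Hc|lra|lra|].
      exists w. split; [exact Hw|]. rewrite iter_add, Ew. exact Ev.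
    - intros y Hy. apply (intermediate_value (iter g (n2 - n1)));
        [apply iter_continuity, Hc|lra|lra]. }
  destruct Hlz as [Hlz|Hlz].
  - destruct (continuity_eps g l Hc (z - l)) as [d1 [Hd1 Hc1]]; [lra|].
    (* A point of the orbit within e of l, and its image, lie below z. If the point were not below
       l, it would be a double rise at or above l, contrary to [HUl]. *)
    set (e := Rmin d1 (z - l)).
    assert (He : e > 0) by (apply Rmin_glb_lt; lra).
    assert (He1 : e <= d1) by apply Rmin_l. assert (He2 : e <= z - l) by apply Rmin_r.
    destruct (continuity_eps g l Hc e He) as [d2 [Hd2 Hc2]].
    destruct (Hnear d2 Hd2) as [n [Hn Hm]].
    assert (Hstay : forall k, X (n + k)%nat < l).
    { induction k as [|k IH]; [rewrite Nat.add_0_r; apply HUl, Hn|].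
      rewrite Nat.add_succ_r. specialize (Hm (n + k)%nat ltac:(lia)).
      assert (HR : Rabs (g (X (n + k)%nat) - g l) < e) by (apply Hc2, Rabs_def1; lra).
      change (g (X (n + k)%nat)) with (X (S (n + k))) in HR.
      apply Rabs_def2 in HR.
      apply Rnot_le_lt. intros Hle.
      assert (HR' : Rabs (g (X (S (n + k))) - g l) < z - l) by (apply Hc1, Rabs_def1; lra).
      apply Rabs_def2 in HR'. change (g (X (S (n + k)))) with (X (S (S (n + k)))) in HR'.
      assert (X (S (n + k)) < l); [|lra]. apply HUl. split; lra. }
    apply Hnc. apply (eventually_increasing_converges _ n); [exact HIn|].
    intros k Hk. specialize (Hstay (k - n)%nat). replace (n + (k - n))%nat with k in Hstay by lia.
    destruct (Hdiv k); lra.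
  - subst l. apply Hnc. exists z. intros e He.
    destruct (continuity_eps g z Hc e He) as [d [Hd Hcd]].
    destruct (Hnear (Rmin d e)) as [n [Hn Hm]]; [apply Rmin_glb_lt; lra|].
    assert (H1 := Rmin_l d e). assert (H2 := Rmin_r d e).
    (* From the left of z, the orbit is close enough that its image stays below z + e; from the
       right it moves down. *)
    assert (Hstay : forall k, X (n + k)%nat < z + e).
    { induction k as [|k IH]; [rewrite Nat.add_0_r; destruct Hn; lra|].
      rewrite Nat.add_succ_r. specialize (Hm (n + k)%nat ltac:(lia)).
      destruct (Hdiv (n + k)%nat) as [H|H]; [|lra].
      assert (HR : Rabs (g (X (n + k)%nat) - g z) < e) by (apply Hcd, Rabs_def1; lra).
      change (g (X (n + k)%nat)) with (X (S (n + k))) in HR. apply Rabs_def2 in HR. lra. }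
    exists n. intros k Hk. specialize (Hstay (k - n)%nat).
    replace (n + (k - n))%nat with k in Hstay by lia. specialize (Hm k ltac:(lia)).
    unfold Rdist. change (iter g k x) with (X k). apply Rabs_def1; lra.
Qed.

(** Double rises below z end eventually, and so do, by reflection, double falls above z. The side
    occupied at the even time 2N then fixes the parity. *)
Lemma nonconvergent_orbit_alternates g x : tame g -> inI x -> ~ converges (fun n => iter g n x) ->
  exists z N, (forall n, (N <= n)%nat -> iter g (2 * n) x < z < iter g (2 * n + 1) x) \/
              (forall n, (N <= n)%nat -> iter g (2 * n + 1) x < z < iter g (2 * n) x).
Proof.
  intros Hg Hx Hnc.
  destruct (nonconvergent_orbit_divided g x Hg Hx Hnc) as [z [Hz [HzI Hdiv]]].
  destruct (finitely_many_double_rises g x z Hg Hx Hnc Hz HzI Hdiv) as [N1 HN1].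
  assert (Hinv : forall t, 1 - (1 - t) = t) by (intros; ring).
  destruct (finitely_many_double_rises (mirror g) (1 - x) (1 - z)) as [N2 HN2].
  { apply tame_mirror, Hg. }
  { unfold inI in *; lra. }
  { intros [p Hp]. apply Hnc, converges_mirror. exists p. intros e He.
    destruct (Hp e He) as [N HN]. exists N. intros n Hn. specialize (HN n Hn).
    rewrite iter_mirror, Hinv in HN. exact HN. }
  { unfold mirror. rewrite Hinv, Hz. reflexivity. }
  { unfold inI in *; lra. }
  { intros n. rewrite !iter_mirror, Hinv. specialize (Hdiv n). lra. }
  assert (Hup : forall n, (N1 + N2 <= n)%nat -> iter g n x < z -> z < iter g (S n) x).
  { intros n Hn. apply HN1. lia. }
  assert (Hdown : forall n, (N1 + N2 <= n)%nat -> z < iter g n x -> iter g (S n) x < z).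
  { intros n Hn Hlt. specialize (HN2 n ltac:(lia)). rewrite !iter_mirror, Hinv in HN2. lra. }
  set (N := (N1 + N2)%nat) in *. exists z, N.
  destruct (Hdiv (2 * N)%nat) as [[H0 _]|[H0 _]]; [left|right]; intros n Hn.
  - assert (Hn' : iter g (2 * n) x < z).
    { induction Hn as [|n Hn IH]; [exact H0|].
      replace (2 * S n)%nat with (S (S (2 * n))) by lia.
      apply Hdown; [lia|]. apply Hup; [lia|exact IH]. }
    split; [exact Hn'|]. rewrite Nat.add_1_r. apply Hup; [lia|exact Hn'].
  - assert (Hn' : z < iter g (2 * n) x).
    { induction Hn as [|n Hn IH]; [exact H0|].
      replace (2 * S n)%nat with (S (S (2 * n))) by lia.
      apply Hup; [lia|]. apply Hdown; [lia|exact IH]. }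
    split; [|exact Hn']. rewrite Nat.add_1_r. apply Hdown; [lia|exact Hn'].
Qed.

(** * Total width of the residue classes of an orbit *)

Fixpoint sum_below (n : nat) (w : nat -> R) : R :=
  match n with O => 0 | S n => sum_below n w + w n end.

Lemma sum_below_const n c : sum_below n (fun _ => c) = INR n * c.
Proof. induction n as [|n IH]; [simpl; ring|]. rewrite S_INR. simpl. rewrite IH. ring. Qed.

Lemma sum_below_plus n u v :
  sum_below n (fun i => u i + v i) = sum_below n u + sum_below n v.
Proof. induction n as [|n IH]; simpl; [ring|rewrite IH; ring]. Qed.

Lemma exists_small_term n w c : sum_below n w < INR n * c -> exists i, (i < n)%nat /\ w i < c.
Proof.
  induction n as [|n IH]; intros H; [simpl in H; lra|]. rewrite S_INR in H. simpl in H.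
  destruct (Rlt_le_dec (w n) c) as [Hlt|Hle]; [exists n; auto|].
  destruct IH as [i [Hi Hw]]; [lra|]. exists i; auto.
Qed.

Lemma sum_below_interleave n u v :
  sum_below (2 * n) (fun i => if Nat.even i then u (Nat.div2 i) else v (Nat.div2 i)) =
  sum_below n u + sum_below n v.
Proof.
  induction n as [|n IH]; [simpl; ring|].
  replace (2 * S n)%nat with (S (S (2 * n))) by lia. cbn [sum_below]. rewrite IH.
  rewrite Nat.even_succ, Nat.odd_mul, Nat.even_mul, Nat.div2_succ_double, Nat.div2_double.
  simpl. ring.
Qed.

Definition residue_widths (g : R -> R) (x : R) (K N : nat) (w : nat -> R) : Prop :=
  forall i, (i < K)%nat -> forall j1 j2, (N <= j1)%nat -> (N <= j2)%nat ->
    Rabs (iter g (i + K * j1) x - iter g (i + K * j2) x) <= w i.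

(* Alternation confines the even and the odd times to the two sides of z, so passing to g o g splits [L, R] between the two half-orbits without increasing the total width. *)
Lemma residue_widths_exist k : forall g x a b eta N0, tame g -> inI x -> eta > 0 ->
  (forall n, (N0 <= n)%nat -> a <= iter g n x <= b) ->
  exists N w, residue_widths g x (2 ^ k) N w /\ sum_below (2 ^ k) w <= b - a + eta.
Proof.
  induction k as [|k IH]; intros g x a b eta N0 Hg Hx Heta Hab.
  { exists N0, (fun _ => b - a). split; [|simpl; lra].
    intros i Hi j1 j2 H1 H2. simpl in *.
    assert (A1 := Hab (i + (j1 + 0))%nat ltac:(lia)).
    assert (A2 := Hab (i + (j2 + 0))%nat ltac:(lia)). apply Rabs_le. lra. }
  destruct (classic (converges (fun n => iter g n x))) as [[p Hp]|Hnc].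
  - assert (HK : 0 < INR (2 ^ S k)) by (apply lt_0_INR, Nat.neq_0_lt_0, Nat.pow_nonzero; lia).
    assert (Hba := Hab N0 (le_n _)).
    (* After convergence every residue gets an equal share of eta; the further half is for comparing
       two points through the limit. *)
    destruct (Hp (eta / INR (2 ^ S k) / 2)) as [N HN].
    { apply Rdiv_lt_0_compat; [|lra]. apply Rdiv_lt_0_compat; lra. }
    exists N, (fun _ => eta / INR (2 ^ S k)). split.
    + assert (HK' : (2 ^ S k <> 0)%nat) by (apply Nat.pow_nonzero; lia).
      intros i Hi j1 j2 H1 H2.
      assert (A1 := HN (i + 2 ^ S k * j1)%nat ltac:(nia)).
      assert (A2 := HN (i + 2 ^ S k * j2)%nat ltac:(nia)).
      unfold Rdist in *. apply Rabs_def2 in A1, A2. apply Rabs_le. lra.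
    + rewrite sum_below_const. replace (INR (2 ^ S k) * (eta / INR (2 ^ S k))) with eta by (field; lra).
      lra.
  (* The even and odd times are the orbits of x and g x under g o g. Residue i modulo 2^(k+1)
     becomes residue i / 2 modulo 2^k of the half-orbit given by the parity of i, and each half
     receives eta / 2. *)
  - assert (Hsplit : forall a1 b1 a2 b2 N, (b1 - a1) + (b2 - a2) = b - a ->
      (forall n, (N <= n)%nat -> a1 <= iter g (2 * n) x <= b1 /\ a2 <= iter g (2 * n + 1) x <= b2) ->
      exists N w, residue_widths g x (2 ^ S k) N w /\ sum_below (2 ^ S k) w <= b - a + eta).
    { intros a1 b1 a2 b2 N Hsum HN.
      assert (Hodd : forall n, iter (fun t => g (g t)) n (g x) = iter g (2 * n + 1) x).
      { intros n. rewrite iter_double, Nat.add_1_r, iter_S_r. reflexivity. }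
      destruct (IH (fun t => g (g t)) x a1 b1 (eta / 2) N) as [Ne [we [He Hse]]];
        [apply tame_double, Hg|exact Hx|lra| |].
      { intros n Hn. rewrite iter_double. apply HN, Hn. }
      destruct (IH (fun t => g (g t)) (g x) a2 b2 (eta / 2) N) as [No [wo [Ho Hso]]];
        [apply tame_double, Hg|apply Hg, Hx|lra| |].
      { intros n Hn. rewrite Hodd. apply HN, Hn. }
      exists (Ne + No)%nat,
        (fun i => if Nat.even i then we (Nat.div2 i) else wo (Nat.div2 i)).
      split; [|rewrite Nat.pow_succ_r', sum_below_interleave; lra].
      intros i Hi j1 j2 H1 H2. rewrite Nat.pow_succ_r' in *.
      assert (Ei := Nat.div2_odd i). rewrite <- Nat.negb_even in Ei.
      set (h := Nat.div2 i) in *.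
      destruct (Nat.even i); simpl Nat.b2n in Ei.
      + specialize (He h ltac:(lia) j1 j2 ltac:(lia) ltac:(lia)). rewrite !iter_double in He.
        replace (i + 2 * 2 ^ k * j1)%nat with (2 * (h + 2 ^ k * j1))%nat by lia.
        replace (i + 2 * 2 ^ k * j2)%nat with (2 * (h + 2 ^ k * j2))%nat by lia. exact He.
      + specialize (Ho h ltac:(lia) j1 j2 ltac:(lia) ltac:(lia)). rewrite !Hodd in Ho.
        replace (i + 2 * 2 ^ k * j1)%nat with (2 * (h + 2 ^ k * j1) + 1)%nat by lia.
        replace (i + 2 * 2 ^ k * j2)%nat with (2 * (h + 2 ^ k * j2) + 1)%nat by lia. exact Ho. }
    destruct (nonconvergent_orbit_alternates g x Hg Hx Hnc) as [z [N [Halt|Halt]]].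
    + apply (Hsplit a z z b (N + N0)%nat); [ring|]. intros n Hn.
      specialize (Halt n ltac:(lia)).
      assert (A1 := Hab (2 * n)%nat ltac:(lia)). assert (A2 := Hab (2 * n + 1)%nat ltac:(lia)). lra.
    + apply (Hsplit z b a z (N + N0)%nat); [ring|]. intros n Hn.
      specialize (Halt n ltac:(lia)).
      assert (A1 := Hab (2 * n)%nat ltac:(lia)). assert (A2 := Hab (2 * n + 1)%nat ltac:(lia)). lra.
Qed.

(** * Proximality along residues and transitivity *)

Lemma uniform_continuity_I (h : R -> R) : continuity h -> forall eps, eps > 0 ->
  exists d, d > 0 /\ forall u v, inI u -> inI v -> Rabs (u - v) < d -> Rabs (h u - h v) < eps.
Proof.
  intros Hc eps He.
  destruct (Heine h (fun c => 0 <= c <= 1) (compact_P3 0 1) (fun x _ => Hc x) (mkposreal eps He))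
    as [d Hd].
  exists d. split; [apply cond_pos|]. intros u v Hu Hv. apply Hd; auto.
Qed.

Lemma iterates_equicontinuous (g : R -> R) K : continuity g -> forall eps, eps > 0 ->
  exists d, d > 0 /\ forall r u v, (r < K)%nat -> inI u -> inI v -> Rabs (u - v) < d ->
    Rabs (iter g r u - iter g r v) < eps.
Proof.
  intros Hc eps He. induction K as [|K [d1 [Hd1 H1]]]; [exists 1; split; [lra|lia]|].
  destruct (uniform_continuity_I (iter g K) (iter_continuity g K Hc) eps He) as [d2 [Hd2 H2]].
  exists (Rmin d1 d2). split; [apply Rmin_glb_lt; lra|].
  intros r u v Hr Hu Hv Huv. assert (A1 := Rmin_l d1 d2). assert (A2 := Rmin_r d1 d2).
  destruct (Nat.eq_dec r K) as [->|Hne].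
  - apply H2; auto; lra.
  - apply H1; auto; [lia|lra].
Qed.

(** Sufficient closeness at one time persists for K consecutive times by equicontinuity, and one of
    these is congruent to i modulo K. *)
Lemma proximal_along_residue g x y K i : continuity g -> maps_I g -> inI x -> inI y ->
  proximal g x y -> (i < K)%nat -> forall eps, eps > 0 -> forall N, exists j, (N <= j)%nat /\
    Rabs (iter g (i + K * j) x - iter g (i + K * j) y) < eps.
Proof.
  intros Hc HI Hx Hy Hp Hi eps He N.
  destruct (iterates_equicontinuous g K Hc eps He) as [d [Hd Heq]].
  destruct (Hp d Hd (i + K * N)%nat) as [n [Hn Hclose]].
  assert (Hex : exists j r, (r < K)%nat /\ (N <= j)%nat /\ (i + K * j = r + n)%nat).
  (* Adding K - 1 rounds the quotient up, so i + K j is the first time of the class at or after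
     n. *)
  { assert (E := Nat.div_mod (n - i + (K - 1)) K ltac:(lia)).
    assert (Hm := Nat.mod_upper_bound (n - i + (K - 1)) K ltac:(lia)).
    set (j := ((n - i + (K - 1)) / K)%nat) in *.
    exists j, (i + K * j - n)%nat. repeat split; nia. }
  destruct Hex as [j [r [Hr [Hj E]]]]. exists j. split; [exact Hj|].
  rewrite E, !iter_add. apply Heq; auto; apply iter_maps_I; auto.
Qed.

Lemma proximal_trans g x y z : tame g -> inI x -> inI y -> inI z ->
  proximal g x y -> proximal g y z -> proximal g x z.
Proof.
  intros Hg Hx Hy Hz Hxy Hyz eps He N. destruct (Hg) as [Hc [HI _]].
  (* The three orbits have total width at most 2 each, so 2^k classes with 2^k eps / 4 > 6 leave one
     of joint width below eps / 4. *)
  assert (Hk : exists k, 6 < INR (2 ^ k) * (eps / 4)).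
  { destruct (Pow_x_infinity 2 ltac:(rewrite Rabs_right; lra) (24 / eps + 1)) as [k Hk].
    exists k. specialize (Hk k (le_n k)). rewrite pow_INR. replace (INR 2) with 2 by (simpl; lra).
    rewrite Rabs_right in Hk by (apply Rle_ge, pow_le; lra).
    assert (24 / eps * eps = 24) by (field; lra). nra. }
  destruct Hk as [k Hk]. set (K := (2 ^ k)%nat) in *.
  assert (Hw : forall t, inI t -> exists N w, residue_widths g t K N w /\ sum_below K w <= 2).
  { intros t Ht. destruct (residue_widths_exist k g t 0 1 1 0 Hg Ht) as [N' [w [Hw Hs]]]; [lra| |].
    - intros n _. apply (iter_maps_I g n t HI Ht).
    - exists N', w. split; [exact Hw|fold K in Hs; lra]. }
  destruct (Hw x Hx) as [Nx [wx [Hwx Hsx]]]. destruct (Hw y Hy) as [Ny [wy [Hwy Hsy]]].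
  destruct (Hw z Hz) as [Nz [wz [Hwz Hsz]]].
  destruct (exists_small_term K (fun i => wx i + (wy i + wz i)) (eps / 4)) as [i [Hi Hsmall]].
  { rewrite !sum_below_plus. lra. }
  set (M := (N + Nx + Ny + Nz)%nat).
  destruct (proximal_along_residue g x y K i Hc HI Hx Hy Hxy Hi (eps / 4) ltac:(lra) M)
    as [j1 [Hj1 H1]].
  destruct (proximal_along_residue g y z K i Hc HI Hy Hz Hyz Hi (eps / 4) ltac:(lra) M)
    as [j2 [Hj2 H2]].
  (* The closeness of y and z at j2 is moved to j1 at the cost of the widths of y and z. Comparing
     j1 with itself for x only records that [wx i] is nonnegative. *)
  exists (i + K * j1)%nat. split; [nia|].
  specialize (Hwy i Hi j1 j2 ltac:(lia) ltac:(lia)).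
  specialize (Hwz i Hi j2 j1 ltac:(lia) ltac:(lia)).
  specialize (Hwx i Hi j1 j1 ltac:(lia) ltac:(lia)). rewrite Rminus_diag, Rabs_R0 in Hwx.
  apply Rabs_def2 in H1, H2.
  apply Rabs_def1.
  - assert (A := Rle_abs (iter g (i + K * j1) y - iter g (i + K * j2) y)).
    assert (B := Rle_abs (iter g (i + K * j2) z - iter g (i + K * j1) z)). lra.
  - rewrite Rabs_minus_sym in Hwy, Hwz.
    assert (A := Rle_abs (iter g (i + K * j2) y - iter g (i + K * j1) y)).
    assert (B := Rle_abs (iter g (i + K * j1) z - iter g (i + K * j2) z)). lra.
Qed.

(** * Extension from I to the real line *)

(** The retraction of the line onto I. Composing f with it gives a map continuous on all of R, as
    [continuity] demands, with the same orbits from points of I. *)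
Definition clamp (x : R) : R := Rmax 0 (Rmin 1 x).

Lemma clamp_inI x : inI (clamp x).
Proof.
  unfold clamp, inI. split; [apply Rmax_l|]. apply Rmax_lub; [lra|apply Rmin_l].
Qed.

Lemma clamp_id x : inI x -> clamp x = x.
Proof. unfold clamp, inI. intros H. rewrite Rmin_right by lra. apply Rmax_right; lra. Qed.

Lemma clamp_contraction x y : Rabs (clamp x - clamp y) <= Rabs (x - y).
Proof.
  unfold clamp, Rmax, Rmin.
  repeat destruct (Rle_dec _ _); unfold Rabs; repeat destruct (Rcase_abs _); lra.
Qed.

Lemma clamp_continuity f : cont_on_I f -> continuity (fun x => f (clamp x)).
Proof.
  intros H x eps He. destruct (H (clamp x) (clamp_inI x) eps He) as [d [Hd Hy]].
  exists d. split; [exact Hd|]. intros y [_ Hyx]. simpl in *. unfold Rdist in *.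
  apply Hy; [apply clamp_inI|]. assert (A := clamp_contraction y x). lra.
Qed.

Lemma iter_clamp f n x : maps_I f -> inI x -> iter (fun t => f (clamp t)) n x = iter f n x.
Proof.
  intros HI Hx. induction n as [|n IH]; [reflexivity|].
  rewrite !iter_S, IH, clamp_id; [reflexivity|]. apply iter_maps_I; auto.
Qed.

Lemma zero_entropy_clamp f : maps_I f -> zero_entropy f -> zero_entropy (fun x => f (clamp x)).
Proof.
  intros HI H eps He d Hd. destruct (H eps He d Hd) as [N HN]. exists N. intros n Hn E [H1 [H2 H3]].
  apply HN; [exact Hn|]. split; [exact H1|split; [exact H2|]].
  intros x y Hx Hy Hne. destruct (H3 x y Hx Hy Hne) as [k [Hk HR]]. exists k.
  rewrite !iter_clamp in HR by auto. auto.
Qed.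

Lemma proximal_clamp f x y : maps_I f -> inI x -> inI y ->
  proximal (fun t => f (clamp t)) x y <-> proximal f x y.
Proof.
  intros HI Hx Hy. split; intros H eps He N; destruct (H eps He N) as [n [Hn HR]];
    exists n; (split; [exact Hn|]); rewrite !iter_clamp in * by auto; exact HR.
Qed.

Theorem mainTheorem4 (f : R -> R) (Hf : CII f) (Hh : zero_entropy f) :
  equivalence_on_I (proximal f).
Proof.
  destruct Hf as [HI Hc].
  assert (Hg : tame (fun x => f (clamp x))).
  { split; [exact (clamp_continuity f Hc)|split].
    - intros x _. apply HI, clamp_inI.
    - apply zero_entropy_no_horseshoe, zero_entropy_clamp; auto. }
  split; [|split].
  - intros x _ eps He N. exists N. rewrite Rminus_diag, Rabs_R0. auto.
  - intros x y _ _ H eps He N. destruct (H eps He N) as [n Hn]. exists n.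
    rewrite Rabs_minus_sym. exact Hn.
  - intros x y z Hx Hy Hz Hxy Hyz.
    apply (proximal_clamp f x z HI Hx Hz). apply (proximal_trans _ x y z Hg Hx Hy Hz).
    + apply proximal_clamp; auto.
    + apply proximal_clamp; auto.
Qed.
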